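(* Let $H$ be a definite Bethe--Salpeter matrix. A structured BSE Krylov decomposition of type I of $H$ of order $k$ keeps its structure under (similarity) transformations of the form $\frac12\phi(Q+Q^{-*},\,Q-Q^{-*})$, with $Q\in\mathbb{R}^{k\times k}$ invertible. That is, applying such a similarity transformation to a structured BSE Krylov decomposition of type I yields again a structured BSE Krylov decomposition of type I.
   Context: Notation: $\overline{\,\cdot\,}$ is entrywise complex conjugation, $\cdot^*$ conjugate transpose, $Q^{-*}=(Q^{-1})^*$. For matrices $U,V$ of equal dimensions, $\phi(U,V):=\begin{bmatrix}U & \overline{V}\\ V & \overline{U}\end{bmatrix}$. Definite Bethe--Salpeter matrix: $H=\begin{bmatrix}R & C\\ -\overline{C} & -\overline{R}\end{bmatrix}\in\mathbb{C}^{2n\times 2n}$ with $R=R^*$, $C=C^T$ in $\mathbb{C}^{n\times n}$, such that $\hat H=\begin{bmatrix}R & C\\ \overline{C} & \overline{R}\end{bmatrix}$ is (Hermitian) positive definite. Type I: a structured BSE Krylov decomposition of type I (of order $k$) is a relation $$H\phi(W_k,Z_k)=\phi(W_k,Z_k)\begin{bmatrix}A_k & B_k\\ -B_k & -A_k\end{bmatrix}+\phi(w_{k+1},z_{k+1})\begin{bmatrix}a_{k+1}^* & b_{k+1}^*\\ -b_{k+1}^* & -a_{k+1}^*\end{bmatrix},$$ with $W_k,Z_k\in\mathbb{C}^{n\times k}$, $w_{k+1},z_{k+1}\in\mathbb{C}^n$, and $$A_k=\tfrac{F_k+K_k}{2},\quad B_k=\tfrac{F_k-K_k}{2},\quad a_{k+1}=\tfrac{f_{k+1}+k_{k+1}}{2},\quad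 b_{k+1}=\tfrac{f_{k+1}-k_{k+1}}{2},$$ for some symmetric positive definite $F_k,K_k\in\mathbb{R}^{k\times k}$ and vectors $f_{k+1},k_{k+1}\in\mathbb{R}^k$, where the columns of $\phi([W_k,w_{k+1}],[Z_k,z_{k+1}])$ are linearly independent, and either $f_{k+1}=0$ or $k_{k+1}=0$. Similarity transformation: applying a similarity transformation with an invertible matrix $G$ to a relation $HX=XM+EN$ (basis $X$, Rayleigh quotient $M$, residual term $EN$) means passing to $H(XG)=(XG)(G^{-1}MG)+E(NG)$. *)

(* Defs.v *)
From HB Require Import structures.
From mathcomp Require Import all_boot all_order all_algebra.
From mathcomp Require Import sesquilinear spectral.
From mathcomp Require Import complex.
From mathcomp Require Import reals.

Set Implicit Arguments.
Unset Strict Implicit.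
Unset Printing Implicit Defensive.

Import Order.TTheory GRing.Theory Num.Theory Num.Def.
Local Open Scope ring_scope.
Local Open Scope complex_scope.
Local Open Scope sesquilinear_scope.

Definition phi (R : realType) (m p : nat) (U V : 'M[R[i]]_(m, p)) :
    'M[R[i]]_(m + m, p + p) :=
  block_mx U (map_mx conjC V) V (map_mx conjC U).

Definition cplx (R : realType) (m p : nat) (A : 'M[R]_(m, p)) :
    'M[R[i]]_(m, p) :=
  map_mx (real_complex R) A.

(* In [R[i]], [0 < z] means that [z] is real and positive. *)
Definition herm_posdef (R : realType) (m : nat) (A : 'M[R[i]]_m) : Prop :=
  A ^t* = A /\
  forall x : 'cV[R[i]]_m, x != 0 -> 0 < (x ^t* *m A *m x) ord0 ord0.

Definition sym_posdef (R : realType) (m : nat) (A : 'M[R]_m) : Prop :=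
  A^T = A /\
  forall x : 'cV[R]_m, x != 0 -> 0 < (x^T *m A *m x) ord0 ord0.

Definition definite_bse (R : realType) (n : nat) (H : 'M[R[i]]_(n + n)) :
    Prop :=
  exists S C : 'M[R[i]]_n,
    [/\ S ^t* = S,
        C^T = C,
        H = block_mx S C (- map_mx conjC C) (- map_mx conjC S)
      & herm_posdef (block_mx S C (map_mx conjC C) (map_mx conjC S))].

(* The relation [H X = X M + E N] (basis [X], Rayleigh quotient [M], residual
   term [E N]) is a structured BSE Krylov decomposition of type I of order [k].
   Linear independence of the columns of a matrix is freeness of the rows of
   its transpose. *)
Definition bse_krylov_I (R : realType) (n k : nat) (H : 'M[R[i]]_(n + n))
    (X : 'M[R[i]]_(n + n, k + k)) (M : 'M[R[i]]_(k + k))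
    (E : 'M[R[i]]_(n + n, 1 + 1)) (N : 'M[R[i]]_(1 + 1, k + k)) : Prop :=
  H *m X = X *m M + E *m N /\
  exists (W Z : 'M[R[i]]_(n, k)) (w z : 'cV[R[i]]_n)
         (Fk Kk : 'M[R]_k) (fk kk : 'cV[R]_k),
    let A := cplx (2^-1 *: (Fk + Kk)) in
    let B := cplx (2^-1 *: (Fk - Kk)) in
    let a := cplx (2^-1 *: (fk + kk)) in
    let b := cplx (2^-1 *: (fk - kk)) in
    [/\ X = phi W Z,
        M = block_mx A B (- B) (- A),
        E = phi w z
      & N = block_mx (a ^t*) (b ^t*) (- (b ^t*)) (- (a ^t*))] /\
    [/\ sym_posdef Fk,
        sym_posdef Kk,
        row_free (phi (row_mx W w) (row_mx Z z))^T
      & fk = 0 \/ kk = 0].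

Definition transf (R : realType) (k : nat) (Q : 'M[R]_k) :
    'M[R[i]]_(k + k) :=
  let Qc := cplx Q in
  2^-1 *: phi (Qc + (invmx Qc) ^t*) (Qc - (invmx Qc) ^t*).

(* Main.v *)
Require Import Defs.
From mathcomp Require Import all_boot all_order all_algebra.
From mathcomp Require Import sesquilinear spectral.
From mathcomp Require Import complex.
From mathcomp Require Import reals.
From mathcomp Require Import ring.

(** The idea is to read every structured matrix in the basis of sums and
    differences.  For real [U], [V], the matrix [sumdiff U V] below is
    [diag(U, V)] written in the basis of the vectors [(x, x)] and [(x, -x)], so
    it is multiplicative in the pair [(U, V)] ([sumdiffM]).  In this language
    the transformation is [G = sumdiff Q Q^-T] ([transfE]), and, with
    [J = diag(1, -1)], the Rayleigh quotient is [M = J * sumdiff F K] and the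
    residual coefficient is [N = J * sumdiff f^T k^T] ([signed_sumdiffE]).
    Since [J] exchanges the sum space and the difference space, moving
    [G^-1] across [J] exchanges the two factors of [G^-1]
    ([sumdiff_sign], [transf_rayleigh]).  Hence

      [G^-1 M G = J * sumdiff (Q^T F Q) (Q^-1 K Q^-T)],
      [N G = J * sumdiff (f^T Q) (k^T Q^-T)].

    So [F] and [K] undergo congruences, which keep them symmetric positive
    definite, while [f] and [k] are multiplied by matrices, so that the one
    which vanishes still does.  A product of two matrices of the form [phi] has
    this form again ([phiM]), which takes care of the basis.  Finally, the
    extended basis, including the residual columns, is multiplied by the
    transformation attached to [diag(Q, 1)] ([phi_extend_transf]), which is
    invertible, so its columns remain linearly independent. *)

Set Implicit Arguments.
Unset Strict Implicit.
Unset Printing Implicit Defensive.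

Import GRing.Theory Num.Theory Num.Def.
Local Open Scope ring_scope.
Local Open Scope complex_scope.
Local Open Scope sesquilinear_scope.

Definition sumdiff (R : realType) (m p : nat) (U V : 'M[R]_(m, p)) :
    'M[R]_(m + m, p + p) :=
  block_mx (2^-1 *: (U + V)) (2^-1 *: (U - V))
           (2^-1 *: (U - V)) (2^-1 *: (U + V)).

Definition sign_mx (R : realType) (m : nat) : 'M[R]_(m + m) :=
  block_mx 1%:M 0 0 (- 1%:M).

Lemma sumdiffM (R : realType) (m p q : nat) (U V : 'M[R]_(m, p))
    (U' V' : 'M[R]_(p, q)) :
  sumdiff U V *m sumdiff U' V' = sumdiff (U *m U') (V *m V').
Proof.
rewrite /sumdiff mulmx_block -!scalemxAl -!scalemxAr.
rewrite !(mulmxDl, mulmxDr, mulmxN, mulNmx).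
move: (U *m U') (U *m V') (V *m U') (V *m V') => a b c d.
by congr block_mx; apply/matrixP=> i j; rewrite !mxE; field.
Qed.

Lemma sumdiff1 (R : realType) (m : nat) :
  sumdiff 1%:M 1%:M = 1%:M :> 'M[R]_(m + m).
Proof.
rewrite /sumdiff subrr scaler0 [RHS]scalar_mx_block -mulr2n -scaler_nat.
by rewrite scalerA mulVf ?scale1r // pnatr_eq0.
Qed.

(** Multiplication by [diag(1, -1)] maps [(x, x)] to [(x, -x)] and back. *)
Lemma sumdiff_sign (R : realType) (m p : nat) (U V : 'M[R]_(m, p)) :
  sumdiff U V *m sign_mx R p = sign_mx R m *m sumdiff V U.
Proof.
rewrite /sumdiff /sign_mx !mulmx_block !(mul1mx, mulmx1, mul0mx, mulmx0).
rewrite !(mulmxN, mulNmx, mul1mx, mulmx1, addr0, add0r) -!scalerN !opprB.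
by rewrite [V + U]addrC.
Qed.

Lemma sym_posdef_congr (R : realType) (m : nat) (A T : 'M[R]_m) :
  sym_posdef A -> T \in unitmx -> sym_posdef (T^T *m A *m T).
Proof.
move=> [symA posA] unitT; split; first by rewrite !trmx_mul trmxK symA mulmxA.
move=> x nz_x; have := posA (T *m x); rewrite trmx_mul !mulmxA; apply.
by apply: contra nz_x => /eqP Tx0; rewrite -[x](mulKmx unitT) Tx0 mulmx0.
Qed.

Lemma phiM (R : realType) (m p q : nat) (U V : 'M[R[i]]_(m, p))
    (U' V' : 'M[R[i]]_(p, q)) :
  phi U V *m phi U' V' =
  phi (U *m U' + map_mx conjC V *m V') (V *m U' + map_mx conjC U *m V').
Proof.
have conjMD (A : 'M[R[i]]_(m, p)) (B : 'M[R[i]]_(p, q)) A' B' :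
    map_mx conjC (A *m B + map_mx conjC A' *m B') =
    A' *m map_mx conjC B' + map_mx conjC A *m map_mx conjC B.
  rewrite map_mxD !map_mxM addrC; congr (_ *m _ + _).
  by apply/matrixP=> i j; rewrite !mxE; apply: conjCK.
by rewrite /phi mulmx_block !conjMD [V *m U' + _]addrC.
Qed.

Lemma conj_cplx (R : realType) (m p : nat) (A : 'M[R]_(m, p)) :
  map_mx conjC (cplx A) = cplx A.
Proof. by apply/matrixP=> i j; rewrite !mxE; apply: conjc_real. Qed.

Lemma cplx_adj (R : realType) (m p : nat) (A : 'M[R]_(m, p)) :
  (cplx A) ^t* = cplx A^T.
Proof. by rewrite /cplx map_trmx conj_cplx. Qed.

Lemma cplx_sumdiff (R : realType) (m p : nat) (U V : 'M[R]_(m, p)) :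
  cplx (sumdiff U V) =
  phi (cplx (2^-1 *: (U + V))) (cplx (2^-1 *: (U - V))).
Proof. by rewrite /phi !conj_cplx [LHS]map_block_mx. Qed.

Lemma transfE (R : realType) (k : nat) (Q : 'M[R]_k) :
  transf Q = cplx (sumdiff Q (invmx Q)^T).
Proof.
have half (A B : 'M[R]_k) :
    cplx (2^-1 *: (A + B)) = 2^-1 *: (cplx A + cplx B).
  by rewrite /cplx map_mxZ fmorphV rmorph_nat map_mxD.
rewrite cplx_sumdiff /transf /phi !conj_cplx !half.
have -> : (invmx (cplx Q)) ^t* = cplx (invmx Q)^T.
  by rewrite -cplx_adj /cplx map_invmx.
have -> : cplx (- (invmx Q)^T) = - cplx (invmx Q)^T by rewrite /cplx map_mxN.
by rewrite scale_block_mx map_mxB map_mxD !conj_cplx.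
Qed.

(** The common shape of the Rayleigh quotient, for [U = F] and [V = K], and of
    the residual coefficient, for [U = f^T] and [V = k^T]. *)
Lemma signed_sumdiffE (R : realType) (m p : nat) (U V : 'M[R]_(m, p)) :
  let A := cplx (2^-1 *: (U + V)) in
  let B := cplx (2^-1 *: (U - V)) in
  block_mx A B (- B) (- A) = cplx (sign_mx R m *m sumdiff U V).
Proof.
rewrite /= /sign_mx /sumdiff mulmx_block !(mul0mx, mulNmx, mul1mx, addr0, add0r).
by rewrite /cplx map_block_mx !map_mxN.
Qed.

(** As [sumdiff] is multiplicative, the inverse is [sumdiff Q^-1 Q^T]. *)
Lemma transf_unit (R : realType) (k : nat) (Q : 'M[R]_k) :
  Q \in unitmx -> transf Q \in unitmx.
Proof.
move=> unitQ; rewrite transfE map_unitmx.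
suff /mulmx1_unit[]: sumdiff Q (invmx Q)^T *m sumdiff (invmx Q) Q^T = 1%:M by [].
by rewrite sumdiffM -trmx_mul !mulmxV // trmx1 sumdiff1.
Qed.

(** The left factors [Q^-1], [Q^T] of the inverse change places when they cross
    [sign_mx], which is why each block meets [Q] on the right and [Q^T] on the
    left (resp. [Q^-T] and [Q^-1]): a congruence, and not a similarity. *)
Lemma transf_rayleigh (R : realType) (k : nat) (Q F K : 'M[R]_k) :
  Q \in unitmx ->
  invmx (transf Q) *m cplx (sign_mx R k *m sumdiff F K) *m transf Q =
  cplx (sign_mx R k *m sumdiff (Q^T *m F *m Q)
                               (invmx Q *m K *m (invmx Q)^T)).
Proof.
move=> unitQ; rewrite -mulmxA; apply: (canLR (mulKmx (transf_unit unitQ))).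
rewrite transfE -!map_mxM mulmxA sumdiff_sign -!mulmxA !sumdiffM !mulmxA.
by rewrite -trmx_mul mulmxV // trmx1 !mul1mx.
Qed.

Lemma unitmx_extend (R : realType) (k p : nat) (Q : 'M[R]_k) :
  Q \in unitmx -> block_mx Q 0 0 (1%:M : 'M_p) \in unitmx.
Proof. by rewrite !unitmxE det_ublock det1 mulr1. Qed.

(** Adjoining the residual columns to the basis corresponds to replacing [Q] by
    [diag(Q, 1)], which reduces the freeness of the new extended basis to the
    invertibility of another transformation of the same family. *)
Lemma phi_extend_transf (R : realType) (n k p : nat) (W Z : 'M[R[i]]_(n, k))
    (w z : 'M[R[i]]_(n, p)) (Q : 'M[R]_k) :
  Q \in unitmx ->
  let S := cplx (2^-1 *: (Q + (invmx Q)^T)) in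
  let D := cplx (2^-1 *: (Q - (invmx Q)^T)) in
  phi (row_mx W w) (row_mx Z z) *m transf (block_mx Q 0 0 1%:M) =
  phi (row_mx (W *m S + map_mx conjC Z *m D) w)
      (row_mx (Z *m S + map_mx conjC W *m D) z).
Proof.
move=> unitQ S D.
have invE : invmx (block_mx Q 0 0 1%:M) = block_mx (invmx Q) 0 0 1%:M
    :> 'M[R]_(k + p).
  by rewrite invmx_block_diag ?invmx1 // unitmx_extend.
rewrite transfE cplx_sumdiff phiM invE tr_block_mx !trmx0 trmx1 opp_block_mx.
rewrite !add_block_mx !scale_block_mx !subrr !addr0 !scaler0.
rewrite -mulr2n -scaler_nat scalerA mulVf ?pnatr_eq0 // scale1r.
rewrite /cplx !map_block_mx !map_mx0 map_mx1 -!/(cplx _) -/S -/D.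
rewrite !map_row_mx !mul_row_block !mulmx0 !mulmx1 !addr0 !add0r !add_row_mx.
by rewrite !addr0.
Qed.

Theorem proposition3 (R : realType) (n k : nat) (H : 'M[R[i]]_(n + n))
    (X : 'M[R[i]]_(n + n, k + k)) (M : 'M[R[i]]_(k + k))
    (E : 'M[R[i]]_(n + n, 1 + 1)) (N : 'M[R[i]]_(1 + 1, k + k))
    (Q : 'M[R]_k)
    (hH : definite_bse H)
    (hD : bse_krylov_I H X M E N)
    (hQ : Q \in unitmx) :
  let G := transf Q in
  G \in unitmx /\
  bse_krylov_I H (X *m G) (invmx G *m M *m G) E (N *m G).
Proof.
move=> G; have unitG : G \in unitmx by exact: transf_unit.
split=> //; case: hD => HX [W [Z [w [z [F [K [f [g]]]]]]]] /=.
move=> [[defX defM defE defN] [posF posK freeX fg0]].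
split.
  by rewrite mulmxA HX mulmxDl !mulmxA mulmxK.
set S := cplx (2^-1 *: (Q + (invmx Q)^T)).
set D := cplx (2^-1 *: (Q - (invmx Q)^T)).
exists (W *m S + map_mx conjC Z *m D), (Z *m S + map_mx conjC W *m D), w, z.
exists (Q^T *m F *m Q), (invmx Q *m K *m (invmx Q)^T).
exists (Q^T *m f), (invmx Q *m g).
have residualE (u v : 'cV[R]_k) :
    let a := cplx (2^-1 *: (u + v)) in
    let b := cplx (2^-1 *: (u - v)) in
    block_mx (a ^t*) (b ^t*) (- (b ^t*)) (- (a ^t*)) =
    cplx (sign_mx R 1 *m sumdiff u^T v^T).
  rewrite -signed_sumdiffE /= !cplx_adj.
  by congr block_mx; apply/matrixP=> i j; rewrite !mxE.
split; split=> //.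
- by rewrite defX /G transfE cplx_sumdiff phiM.
- by rewrite defM !signed_sumdiffE transf_rayleigh.
- rewrite defN !residualE /G transfE -map_mxM -mulmxA sumdiffM.
  by rewrite !trmx_mul trmxK.
- exact: sym_posdef_congr.
- rewrite -{1}[invmx Q]trmxK; apply: sym_posdef_congr => //.
  by rewrite unitmx_tr unitmx_inv.
- rewrite -phi_extend_transf // trmx_mul /row_free mxrankMfree //.
  rewrite -/(row_free _) row_free_unit unitmx_tr.
  exact/transf_unit/unitmx_extend.
- by case: fg0 => ->; [left | right]; rewrite mulmx0.
Qed.
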